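(* Let $L^j(q,v)=K(q,v)-V^j(q)$, $j=1,2$, with $K(q,v)=\frac12 g(v,v)$ for a metric tensor $g$ on $Q$, and let $f_L^1,f_L^2$ be forces such that the forced Lagrangian systems $(L^1,f_L^1)$ and $(L^2,f_L^2)$ are equivalent, so that $f_L^1(q,\dot q)-f_L^2(q,\dot q)=\nabla V^1(q)-\nabla V^2(q)$. Choose one quadrature formula with nodes $c_i$ and weights $b_i$, $i=0,\dots,n$, and one boundary-value solution method for the equations of motion, giving approximations $(q^i,v^i)$ (depending on $q_0,q_1,h$) of the solution at times $c_ih$, and use them for all discrete quantities of both systems: $$L_d^j(q_0,q_1;h)=h\sum_{i=0}^n b_iL^j(q^i,v^i),$$ $$f_d^{j+}(q_0,q_1;h)=h\sum_{i=0}^n b_i f_L^j(q^i,v^i)\frac{\partial q^i}{\partial q_1},\qquad f_d^{j-}(q_0,q_1;h)=h\sum_{i=0}^n b_i f_L^j(q^i,v^i)\frac{\partial q^i}{\partial q_0},\qquad j=1,2.$$ Then $$f_d^{1+}-f_d^{2+}=D_2L_d^2-D_2L_d^1,\qquad f_d^{2-}-f_d^{1-}=D_1L_d^1-D_1L_d^2,$$ and thus the triples $(L_d^1,f_d^{1\pm})$ and $(L_d^2,f_d^{2\pm})$ are strongly equivalent.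
   Context: $Q$ is the configuration space (work in local coordinates). A forced Lagrangian system is a pair $(L,f_L)$ with $L:TQ\to\mathbb{R}$ and $f_L:TQ\to T^*Q$ a fiber-preserving map over the identity, with equations of motion $$\frac{\partial L}{\partial q}(q,\dot q)-\frac{d}{dt}\left(\frac{\partial L}{\partial \dot q}(q,\dot q)\right)+f_L(q,\dot q)=0 .$$ Two pairs $(L^1,f_L^1)$, $(L^2,f_L^2)$ are equivalent if they define the same equations of motion. The boundary-value solution method is applied to the equations of motion with boundary conditions $q(0)=q_0$, $q(h)=q_1$; since these equations are the same for both pairs, the approximations $(q^i,v^i)$ are the same for $j=1,2$; they are differentiable functions of $(q_0,q_1)$. $D_1,D_2$ denote derivatives with respect to the first and second arguments. For a triple $(L_d,f_d^{+},f_d^-)$ the forced discrete Legendre transforms are $$\mathbb{F}^{f+}L_d(q_0,q_1)=(q_1,\,D_2L_d(q_0,q_1)+f_d^+(q_0,q_1)),\qquad \mathbb{F}^{f-}L_d(q_0,q_1)=(q_0,\,-D_1L_d(q_0,q_1)-f_d^-(q_0,q_1)),$$ and the discrete Hamiltonian map is $\tilde F^f_{L_d}=\mathbb{F}^{f+}L_d\circ(\mathbb{F}^{f-}L_d)^{-1}$. Two triples are strongly equivalent if they generate the same discrete Hamiltonian map; in the paper this is characterized by equality of the forced discrete Legendre transforms, $\mathbb{F}^{f\pm}L_d^1=\mathbb{F}^{f\pm}L_d^2$. *)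

(* Defs.v *)
From mathcomp Require Import all_boot all_order all_algebra.
From mathcomp Require Import all_classical all_reals all_analysis.
Set Implicit Arguments.
Unset Strict Implicit.
Unset Printing Implicit Defensive.
Import Order.TTheory GRing.Theory Num.Theory.
Import numFieldNormedType.Exports.
Local Open Scope classical_set_scope.
Local Open Scope ring_scope.

(* Everything is written in the coordinates of a chart: the configuration
   space is an open set Q of 'rV[R]_d, an element (q, v) of TQ is a point
   q of Q with a row vector v, and a covector at q is the row of its components
   with respect to dq^1, ..., dq^d. *)

Section ForcedLagrangian.
Context {R : realType} {d : nat}.
Local Notation vec := ('rV[R]_d).

(* The covector (dF/dx^1, ..., dF/dx^d). *)
Definition grad (F : vec -> R) (x : vec) : vec :=
  \row_k 'D_(delta_mx 0 k) F x.

(* The metric is only required to be nondegenerate, so that both the Riemannian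
   and the pseudo-Riemannian cases are covered. *)
Definition metric_tensor (Q : set vec) (g : vec -> 'M[R]_d) : Prop :=
  forall q, Q q ->
    [/\ (g q)^T = g q, g q \in unitmx & differentiable g q].

Definition kinetic (g : vec -> 'M[R]_d) (q v : vec) : R :=
  2^-1 * (v *m g q *m v^T) 0 0.

Definition mechanical (g : vec -> 'M[R]_d) (V : vec -> R) (q v : vec) : R :=
  kinetic g q v - V q.

(* c is a twice differentiable curve in Q around the time t. *)
Definition curve_at (Q : set vec) (c : R -> vec) (t : R) : Prop :=
  (\forall s \near t, Q (c s) /\ derivable c s 1) /\ derivable (derive1 c) t 1.

Definition dLdq (L : vec -> vec -> R) (q v : vec) : vec :=
  grad (fun x => L x v) q.

Definition dLdv (L : vec -> vec -> R) (q v : vec) : vec :=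
  grad (fun w => L q w) v.

(* An equation of motion, as the condition it puts on a curve at a time. *)
Definition equation : Type := (R -> vec) -> R -> Prop.

(* The derivability clause makes the total time derivative in the last clause
   a genuine one. *)
Definition eom (Q : set vec) (L : vec -> vec -> R) (f : vec -> vec -> vec)
    : equation := fun c t =>
  [/\ curve_at Q c t,
      derivable (fun s => dLdv L (c s) (derive1 c s)) t 1 &
      dLdq L (c t) (derive1 c t)
        - derive1 (fun s => dLdv L (c s) (derive1 c s)) t
        + f (c t) (derive1 c t) = 0].

Definition equivalent_systems (Q : set vec)
    (L1 : vec -> vec -> R) (f1 : vec -> vec -> vec)
    (L2 : vec -> vec -> R) (f2 : vec -> vec -> vec) : Prop :=
  forall c t, eom Q L1 f1 c t <-> eom Q L2 f2 c t.

(* The approximations (q^i, v^i) as functions of the boundary points q0, q1. *)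
Definition approximations (n : nat) : Type :=
  vec -> vec -> 'I_n.+1 -> vec * vec.

(* A method only sees the equation of motion, the step h, the nodes c_i and the
   boundary values q(0) = q0, q(h) = q1; nothing is assumed on its accuracy. *)
Definition bvp_method (n : nat) : Type :=
  equation -> R -> ('I_n.+1 -> R) -> approximations n.

Definition regular_on (Q : set vec) (D : set (vec * vec)) (n : nat)
    (a : approximations n) : Prop :=
  forall q0 q1 i, D (q0, q1) ->
    [/\ Q (a q0 q1 i).1,
        differentiable (fun x : vec * vec => (a x.1 x.2 i).1) (q0, q1) &
        differentiable (fun x : vec * vec => (a x.1 x.2 i).2) (q0, q1)].

Record forced_discrete := ForcedDiscrete {
  Ld : vec -> vec -> R;
  fdp : vec -> vec -> vec;
  fdm : vec -> vec -> vec }.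

(* The entry (l, k) is the partial derivative of F^l along x^k; the library's
   jacobian acts on row vectors, hence the transpose. *)
Definition jac (F : vec -> vec) (x : vec) : 'M[R]_d := (jacobian F x)^T.

Definition discretize (n : nat) (L : vec -> vec -> R) (f : vec -> vec -> vec)
    (h : R) (b : 'I_n.+1 -> R) (a : approximations n) : forced_discrete :=
  {| Ld := fun q0 q1 => h * \sum_i b i * L (a q0 q1 i).1 (a q0 q1 i).2;
     fdp := fun q0 q1 => h *: \sum_i b i *:
       (f (a q0 q1 i).1 (a q0 q1 i).2 *m jac (fun y => (a q0 y i).1) q1);
     fdm := fun q0 q1 => h *: \sum_i b i *:
       (f (a q0 q1 i).1 (a q0 q1 i).2 *m jac (fun x => (a x q1 i).1) q0) |}.

Definition D1 (F : vec -> vec -> R) (q0 q1 : vec) : vec :=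
  grad (fun x => F x q1) q0.

Definition D2 (F : vec -> vec -> R) (q0 q1 : vec) : vec :=
  grad (fun y => F q0 y) q1.

Definition legendre_plus (X : forced_discrete) (x : vec * vec) : vec * vec :=
  (x.2, D2 (Ld X) x.1 x.2 + fdp X x.1 x.2).

Definition legendre_minus (X : forced_discrete) (x : vec * vec) : vec * vec :=
  (x.1, - D1 (Ld X) x.1 x.2 - fdm X x.1 x.2).

(* The composite of legendre_plus with the inverse of legendre_minus on D, as a
   set-valued map: the value at p is a singleton for every p in the image of D
   when legendre_minus is injective on D, and is empty off that image. *)
Definition discrete_hamiltonian (D : set (vec * vec)) (X : forced_discrete)
    (p : vec * vec) : set (vec * vec) :=
  legendre_plus X @` (D `&` legendre_minus X @^-1` [set p]).

Definition strongly_equivalent (D : set (vec * vec))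
    (X1 X2 : forced_discrete) : Prop :=
  discrete_hamiltonian D X1 = discrete_hamiltonian D X2.

End ForcedLagrangian.

(* Main.v *)
Require Import Defs.
From mathcomp Require Import all_boot all_order all_algebra.
From mathcomp Require Import all_classical all_reals all_analysis.
From mathcomp Require Import ring.
Import Order.TTheory GRing.Theory Num.Theory.
Import numFieldNormedType.Exports.
Local Open Scope classical_set_scope.
Local Open Scope ring_scope.

Set Implicit Arguments.
Unset Strict Implicit.
Unset Printing Implicit Defensive.

(** The two Lagrangians have the same kinetic energy, hence the same momentum
    v *m g q along every curve in Q, so that subtracting the two equations of motion
    at one instant leaves only grad V2 - grad V1 + (f1 - f2) = 0.  This is an
    identity of functions of (q, v), rather than of curves, because every
    (q, v) is the state at time 0 of some curve that satisfies the equation of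
    motion there: a nondegenerate metric lets the acceleration, and so the rate
    of change of the momentum, be prescribed freely, and a parabola has any
    given position, velocity and acceleration
    (exists_curve_of_momentum_rate).  This gives force_difference.

    A boundary value method sees nothing but the equation of motion, so it
    produces the same points (q^i, v^i) for both systems.  The kinetic terms of
    the two discrete Lagrangians then agree, and by the chain rule
    D2 Ld2 - D2 Ld1 is h times the sum of
    b_i (grad V1 - grad V2)(q^i) dq^i/dq1 (grad_discrete_action_sub).  By
    force_difference the latter is the difference of the discrete forces; the
    argument for D1 is the same.  These identities say that the forced discrete
    Legendre transforms coincide on D, and the discrete Hamiltonian map is
    built from those transforms alone. *)

(** * Derivatives of matrix-valued maps *)

Section MatrixDerivative.
Context {R : realType} {U : normedModType R}.

Lemma is_derive_mx m n (M : U -> 'M[R]_(m, n)) x u (M' : 'M[R]_(m, n)) :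
  (forall i j, is_derive x u (fun y => M y i j) (M' i j)) -> is_derive x u M M'.
Proof.
move=> dM.
have dMx : derivable M x u by apply/derivable_mxP => i j; exact: ex_derive.
apply: DeriveDef => //; rewrite derive_mx//.
by apply/matrixP => i j; rewrite mxE; exact: derive_val.
Qed.

Lemma is_derive_mxE m n (M : U -> 'M[R]_(m, n)) x u (M' : 'M[R]_(m, n)) i j :
  is_derive x u M M' -> is_derive x u (fun y => M y i j) (M' i j).
Proof.
move=> [dM <-]; apply: DeriveDef; first by move/derivable_mxP: dM.
by rewrite derive_mx// mxE.
Qed.

Lemma is_derive_trmx m n (M : U -> 'M[R]_(m, n)) x u M' :
  is_derive x u M M' -> is_derive x u (fun y => (M y)^T) M'^T.
Proof.
move=> dM; apply: is_derive_mx => i j.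
under eq_fun do rewrite mxE.
by rewrite mxE; exact: is_derive_mxE.
Qed.

Lemma is_derive_mulmx m n p (M : U -> 'M[R]_(m, n)) (N : U -> 'M[R]_(n, p))
    x u M' N' :
  is_derive x u M M' -> is_derive x u N N' ->
  is_derive x u (fun y => M y *m N y) (M' *m N x + M x *m N').
Proof.
move=> dM dN; apply: is_derive_mx => i j.
have -> : (fun y => (M y *m N y) i j)
    = \sum_k ((fun y => M y i k) * (fun y => N y k j)).
  by apply/funext => y; rewrite mxE fct_sumE.
have dk k := is_deriveM (is_derive_mxE i k dM) (is_derive_mxE k j dN).
apply: is_derive_eq.
rewrite !mxE -big_split /=; apply: eq_bigr => k _.
by rewrite addrC; congr (_ + _); exact: mulrC.
Qed.

End MatrixDerivative.

(** * Mechanical Lagrangians *)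

Section Mechanics.
Context {R : realType} {d : nat}.
Local Notation vec := ('rV[R]_d).
Implicit Types (g : vec -> 'M[R]_d) (V : vec -> R) (q v : vec).

Lemma derivable_kinetic (U : normedModType R) g (q v : U -> vec) x u :
  differentiable q x -> differentiable v x -> differentiable g (q x) ->
  derivable (fun y => kinetic g (q y) (v y)) x u.
Proof.
move=> dq dv dg.
have hv : is_derive x u v ('D_u v x) by apply/derivableP/diff_derivable.
have hg : is_derive x u (g \o q) ('D_u (g \o q) x).
  exact/derivableP/diff_derivable/differentiable_comp.
have := is_derive_mulmx (is_derive_mulmx hv hg) (is_derive_trmx hv).
by move=> /(is_derive_mxE 0 0) [hK _]; exact: derivableZ.
Qed.

(** The potential does not depend on v, and the symmetry of the metric merges the
    two halves of the derivative of the quadratic form: both systems have this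
    same momentum. *)
Lemma dLdv_mechanical g V q v :
  (g q)^T = g q -> dLdv (mechanical g V) q v = v *m g q.
Proof.
move=> gT; apply/rowP => k; rewrite mxE.
set e := delta_mx 0 k.
have hc : is_derive v e (cst (g q)) (0 : 'M[R]_d) by exact: is_derive_cst.
have hv : is_derive v e (id : vec -> vec) e by exact: is_derive_id.
have := is_derive_mulmx (is_derive_mulmx hv hc) (is_derive_trmx hv).
move=> /(is_derive_mxE 0 0) hK.
rewrite /mechanical /kinetic.
rewrite (_ : (fun w => _) = 2^-1 *: (fun y : vec =>
   (y *m cst (g q) y *m y^T) 0 0) - cst (V q)) //.
rewrite derive_val subr0 mulmx0 addr0 mxE.
have -> : e *m cst (g q) v *m v^T = (v *m g q *m e^T)^T.
  by rewrite !trmx_mul trmxK gT mulmxA.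
rewrite mxE /=.
have -> : (v *m g q *m e^T) 0 0 = (v *m g q) 0 k.
  by rewrite /e trmx_delta -colE mxE.
by rewrite /GRing.scale /=; field.
Qed.

Lemma dLdq_mechanical g V q v :
  differentiable g q -> differentiable V q ->
  dLdq (mechanical g V) q v = grad (kinetic g ^~ v) q - grad V q.
Proof.
move=> dg dV; apply/rowP => k; rewrite !mxE.
apply: (@deriveB _ _ _ (kinetic g ^~ v)); last exact: diff_derivable.
exact: derivable_kinetic.
Qed.

(** * Recovering the forces from the equations of motion *)

Definition parabola q v (w : vec) (t : R) : vec :=
  q + t *: v + (t ^+ 2 / 2) *: w.

Lemma is_derive_parabola q v (w : vec) (t : R) :
  is_derive t (1 : R) (parabola q v w) (v + t *: w).
Proof.
apply: is_derive_mx => i j.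
have -> : (fun y => parabola q v w y i j) =
   cst (q i j) + v i j *: id + (w i j / 2) *: (id ^+ 2 : R -> R).
  apply/funext => y; rewrite !mxE.
  rewrite -[RHS]/(q i j + v i j * y + w i j / 2 * y ^+ 2).
  by field.
have d1 : is_derive t (1 : R) (id : R -> R) 1 by exact: is_derive_id.
have := is_deriveD
  (is_deriveD (is_derive_cst (q i j) t (1 : R)) (is_deriveZ (v i j) d1))
  (is_deriveZ (w i j / 2) (is_deriveX 2 d1)).
rewrite [X in is_derive _ _ _ X](_ : _ = (v + t *: w) i j) //.
by rewrite !mxE /GRing.scale /=; field.
Qed.

(** The momentum along c has derivative c'' g + c' (Dg c'), where g is invertible;
    the acceleration of a parabola is solved from this for the prescribed
    rate p. *)
Lemma exists_curve_of_momentum_rate (Q : set vec) g q v (p : vec) :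
  open Q -> metric_tensor Q g -> Q q ->
  exists2 c : R -> vec, curve_at Q c 0 &
    [/\ c 0 = q, derive1 c 0 = v &
        is_derive (0 : R) (1 : R) (fun s => derive1 c s *m g (c s)) p].
Proof.
move=> oQ mg Qq; have [_ gU dg] := mg q Qq.
(* the acceleration: w *m g q + v *m 'd g q v = p *)
pose w := (p - v *m 'd g q v) *m invmx (g q).
pose c := parabola q v w.
have c0 : c 0 = q by rewrite /c /parabola expr0n /= mul0r !scale0r !addr0.
have c1 : derive1 c = fun t => v + t *: w.
  apply/funext => t; rewrite derive1E.
  by have [_ <-] := is_derive_parabola q v w t.
have dc t : derivable c t 1 by have [] := is_derive_parabola q v w t.
have dc1 : is_derive (0 : R) (1 : R) (derive1 c) w.
  rewrite c1; apply: is_derive_mx => i j.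
  have -> : (fun y : R => (v + y *: w) i j) = cst (v i j) + w i j *: id.
    by apply/funext => y; rewrite !mxE mulrC.
  have := is_deriveD (is_derive_cst (v i j) (0 : R) (1 : R))
    (is_deriveZ (w i j) (is_derive_id (0 : R) (1 : R))).
  by rewrite [X in is_derive _ _ _ X](_ : _ = w i j)// add0r; exact: mulr1.
have Qc : \forall s \near (0 : R), Q (c s).
  have /differentiable_continuous cc : differentiable c (0 : R).
    exact/derivable1_diffP.
  by apply: cc; rewrite c0; exact: open_nbhs_nbhs.
exists c.
  split; last exact: ex_derive.
  by near=> s; split=> //; near: s.
split=> //; first by rewrite c1 scale0r addr0.
have dcd : differentiable c (0 : R) by exact/derivable1_diffP.
have dgc : is_derive (0 : R) (1 : R) (g \o c) ('d g q v).
  have dgcd : differentiable (g \o c) (0 : R).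
    by apply: differentiable_comp => //; rewrite c0.
  apply: DeriveDef; first exact: diff_derivable.
  rewrite deriveE// diff_comp//; last by rewrite c0.
  by rewrite /= c0 -derive1E'// c1 scale0r addr0.
have := is_derive_mulmx dc1 dgc.
by rewrite /= c1 c0 scale0r addr0 /w mulmxKV// subrK.
Unshelve. all: by end_near. Qed.

(** A curve through (q, v) is made to satisfy the first equation of motion at
    time 0; it then satisfies the second one, and the two have the same momentum
    rate and the same kinetic part of dL/dq. *)
Lemma force_difference (Q : set vec) g V1 V2 (f1 f2 : vec -> vec -> vec) q v :
  open Q -> metric_tensor Q g ->
  differentiable V1 q -> differentiable V2 q ->
  equivalent_systems Q (mechanical g V1) f1 (mechanical g V2) f2 ->
  Q q -> f1 q v - f2 q v = grad V1 q - grad V2 q.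
Proof.
move=> oQ mg dV1 dV2 eqv Qq; have [_ _ dg] := mg q Qq.
(* the momentum rate that the first equation of motion demands at (q, v) *)
pose p := dLdq (mechanical g V1) q v + f1 q v.
have [c cQ [c0 c1 [dm mE]]] := exists_curve_of_momentum_rate v p oQ mg Qq.
have momentumE V : \forall s \near (0 : R),
    derive1 c s *m g (c s) = dLdv (mechanical g V) (c s) (derive1 c s).
  have [+ _] := cQ; apply: filterS => s [/mg[gT _ _] _].
  by rewrite dLdv_mechanical.
have rate V :
    derive1 (fun s => dLdv (mechanical g V) (c s) (derive1 c s)) 0 = p.
  by rewrite derive1E -mE; apply/esym/near_eq_derive/momentumE.
have eom1 : eom Q (mechanical g V1) f1 c 0.
  split; [exact: cQ | exact: near_eq_derivable (momentumE V1) dm | ].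
  rewrite rate c0 c1 addrAC.
  exact: subrr.
have [_ _] := (eqv c 0).1 eom1.
rewrite rate c0 c1 /p !dLdq_mechanical//.
move=> /eqP; rewrite addr_eq0 => /eqP E.
rewrite -[f2 q v]opprK -E.
by apply/rowP => k; rewrite !mxE; ring.
Qed.

(** * Discrete Lagrangians *)

Lemma grad_comp V (q : vec -> vec) x :
  differentiable q x -> differentiable V (q x) ->
  grad (V \o q) x = grad V (q x) *m jac q x.
Proof.
move=> dq dV; apply/rowP => k; rewrite !mxE.
have dVq : differentiable (V \o q) x by exact: differentiable_comp.
rewrite deriveE// diff_comp//=.
rewrite [X in 'd V _ X]row_sum_delta linear_sum; apply: eq_bigr => l _.
by rewrite linearZ /= !mxE deriveE// mulrC.
Qed.

(** Here x stands for either of the boundary points q0, q1, the other one being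
    fixed.  The kinetic terms cancel in the difference, but their derivability
    along the approximations has to be known: the gradient of a sum splits only
    when every term has directional derivatives. *)
Lemma grad_discrete_action_sub g V1 V2 n (b : 'I_n.+1 -> R) (h : R)
    (q v : vec -> 'I_n.+1 -> vec) x :
  (forall i, differentiable (q ^~ i) x) ->
  (forall i, differentiable (v ^~ i) x) ->
  (forall i, differentiable g (q x i)) ->
  (forall i, differentiable V1 (q x i)) ->
  (forall i, differentiable V2 (q x i)) ->
  grad (fun y => h * \sum_i b i * mechanical g V2 (q y i) (v y i)) x
    - grad (fun y => h * \sum_i b i * mechanical g V1 (q y i) (v y i)) x
  = h *: \sum_i b i *:
      ((grad V1 (q x i) - grad V2 (q x i)) *m jac (q ^~ i) x).
Proof.
move=> dq dv dg dV1 dV2.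
pose K i (y : vec) : R := kinetic g (q y i) (v y i).
have gradS V : (forall i, differentiable V (q x i)) ->
    grad (fun y => h * \sum_i b i * mechanical g V (q y i) (v y i)) x
    = h *: \sum_i b i *: (grad (K i) x - grad V (q x i) *m jac (q ^~ i) x).
  move=> dV; apply/rowP => k; set e : vec := delta_mx 0 k.
  have dK i : is_derive x e (K i) ('D_e (K i) x).
    by apply/derivableP/derivable_kinetic.
  have dVq i : is_derive x e (V \o (q ^~ i)) ('D_e (V \o (q ^~ i)) x).
    by apply/derivableP/diff_derivable/differentiable_comp.
  rewrite mxE -/e.
  have -> : (fun y => h * \sum_i b i * mechanical g V (q y i) (v y i))
      = h *: \sum_i b i *: (K i - (V \o (q ^~ i))).
    by apply/funext => y; rewrite -[RHS]/(h * _) fct_sumE.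
  rewrite derive_val mxE summxE; congr (h * _); apply: eq_bigr => i _.
  by rewrite mxE -grad_comp// !mxE.
rewrite !gradS// -scalerBr -sumrB; congr (_ *: _); apply: eq_bigr => i _.
by rewrite -scalerBr mulmxBl; congr (_ *: _); rewrite addrC opprB subrKA.
Qed.

Lemma regular_on_second Q D n (a : @approximations R d n) q0 q1 i :
  regular_on Q D a -> D (q0, q1) ->
  differentiable (fun y => (a q0 y i).1) q1 /\
  differentiable (fun y => (a q0 y i).2) q1.
Proof.
move=> ra D01; have [_ dq dv] := ra _ _ i D01.
have dp : differentiable (fun y : vec => (q0, y)) q1 by [].
by split; [exact: (differentiable_comp dp dq) | exact: (differentiable_comp dp dv)].
Qed.

Lemma regular_on_first Q D n (a : @approximations R d n) q0 q1 i :
  regular_on Q D a -> D (q0, q1) ->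
  differentiable (fun x => (a x q1 i).1) q0 /\
  differentiable (fun x => (a x q1 i).2) q0.
Proof.
move=> ra D01; have [_ dq dv] := ra _ _ i D01.
have dp : differentiable (fun x : vec => (x, q1)) q0 by [].
by split; [exact: (differentiable_comp dp dq) | exact: (differentiable_comp dp dv)].
Qed.

(** The quadrature weights and the factors dq^i/dq0, dq^i/dq1 are common to the
    discrete forces and, by the chain rule, to the gradients of the discrete
    potential terms, so the pointwise relation between the forces passes to the
    sums. *)
Lemma discretize_sub (Q : set vec) (D : set (vec * vec)) g V1 V2
    (f1 f2 : vec -> vec -> vec) n (b : 'I_n.+1 -> R) (h : R)
    (a : @approximations R d n) q0 q1
    (X1 := discretize (mechanical g V1) f1 h b a)
    (X2 := discretize (mechanical g V2) f2 h b a) :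
  (forall q, Q q -> differentiable g q) ->
  (forall q, Q q -> differentiable V1 q) ->
  (forall q, Q q -> differentiable V2 q) ->
  (forall q v, Q q -> f1 q v - f2 q v = grad V1 q - grad V2 q) ->
  regular_on Q D a -> D (q0, q1) ->
  fdp X1 q0 q1 - fdp X2 q0 q1 = D2 (Ld X2) q0 q1 - D2 (Ld X1) q0 q1 /\
  fdm X2 q0 q1 - fdm X1 q0 q1 = D1 (Ld X1) q0 q1 - D1 (Ld X2) q0 q1.
Proof.
move=> dg dV1 dV2 force ra D01.
have Qa i : Q (a q0 q1 i).1 by have [] := ra q0 q1 i D01.
have forceE (J : 'I_n.+1 -> 'M[R]_d) :
    h *: (\sum_i b i *: (f1 (a q0 q1 i).1 (a q0 q1 i).2 *m J i))
      - h *: (\sum_i b i *: (f2 (a q0 q1 i).1 (a q0 q1 i).2 *m J i))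
    = h *: \sum_i b i *:
        ((grad V1 (a q0 q1 i).1 - grad V2 (a q0 q1 i).1) *m J i).
  rewrite -scalerBr -sumrB; congr (_ *: _); apply: eq_bigr => i _.
  by rewrite -scalerBr -mulmxBl force.
split.
- apply: (etrans (forceE _)); apply: esym.
  apply: (@grad_discrete_action_sub g V1 V2 n b h (fun y i => (a q0 y i).1)
    (fun y i => (a q0 y i).2)) => i; [| | exact: dg | exact: dV1 | exact: dV2];
    by have [] := regular_on_second i ra D01.
- (* up to an overall sign, this is the preceding computation *)
  apply: oppr_inj; rewrite !opprB.
  apply: (etrans (forceE _)); apply: esym.
  apply: (@grad_discrete_action_sub g V1 V2 n b h (fun x i => (a x q1 i).1)
    (fun x i => (a x q1 i).2)) => i; [| | exact: dg | exact: dV1 | exact: dV2];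
    by have [] := regular_on_first i ra D01.
Qed.

(** * Discrete Legendre transforms *)

Lemma legendre_eq (X1 X2 : @forced_discrete R d) x :
  fdp X1 x.1 x.2 - fdp X2 x.1 x.2 = D2 (Ld X2) x.1 x.2 - D2 (Ld X1) x.1 x.2 ->
  fdm X2 x.1 x.2 - fdm X1 x.1 x.2 = D1 (Ld X1) x.1 x.2 - D1 (Ld X2) x.1 x.2 ->
  legendre_plus X1 x = legendre_plus X2 x /\
  legendre_minus X1 x = legendre_minus X2 x.
Proof.
rewrite /legendre_plus /legendre_minus.
move: (D1 _ _ _) (D1 _ _ _) (D2 _ _ _) (D2 _ _ _) => A1 A2 B1 B2.
move: (fdp _ _ _) (fdp _ _ _) (fdm _ _ _) (fdm _ _ _) => p1 p2 m1 m2 fp fm.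
split; congr pair; apply/eqP; rewrite -subr_eq0.
- by rewrite opprD addrACA fp subrKA subrr.
- by rewrite opprD !opprK addrACA [- _ + m2]addrC fm addrACA addNr subrr addr0.
Qed.

Lemma legendre_strongly_equivalent (D : set (vec * vec))
    (X1 X2 : @forced_discrete R d) :
  (forall x, D x -> legendre_plus X1 x = legendre_plus X2 x /\
                    legendre_minus X1 x = legendre_minus X2 x) ->
  strongly_equivalent D X1 X2.
Proof.
move=> eqX; apply/funext => p; apply/seteqP; split=> y /= [x [Dx xp] <-];
  have [eqp eqm] := eqX x Dx; exists x => //; split=> //=.
- by rewrite -eqm.
- by rewrite eqm.
Qed.

End Mechanics.

Theorem mainTheorem3 (R : realType) (d : nat) (Q : set 'rV[R]_d)
    (g : 'rV[R]_d -> 'M[R]_d) (V1 V2 : 'rV[R]_d -> R)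
    (f1 f2 : 'rV[R]_d -> 'rV[R]_d -> 'rV[R]_d)
    (n : nat) (b c : 'I_n.+1 -> R) (h : R)
    (method : bvp_method n) (D : set ('rV[R]_d * 'rV[R]_d))
    (L1 := mechanical g V1) (L2 := mechanical g V2)
    (a1 := method (eom Q L1 f1) h c) (a2 := method (eom Q L2 f2) h c)
    (X1 := discretize L1 f1 h b a1) (X2 := discretize L2 f2 h b a2) :
  open Q -> metric_tensor Q g ->
  (forall q, Q q -> differentiable V1 q) ->
  (forall q, Q q -> differentiable V2 q) ->
  equivalent_systems Q L1 f1 L2 f2 ->
  open D -> D `<=` Q `*` Q ->
  regular_on Q D a1 -> regular_on Q D a2 ->
  [/\ (forall q v, Q q -> f1 q v - f2 q v = grad V1 q - grad V2 q),
      (forall q0 q1, D (q0, q1) ->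
         fdp X1 q0 q1 - fdp X2 q0 q1 = D2 (Ld X2) q0 q1 - D2 (Ld X1) q0 q1 /\
         fdm X2 q0 q1 - fdm X1 q0 q1 = D1 (Ld X1) q0 q1 - D1 (Ld X2) q0 q1),
      (forall x, D x -> legendre_plus X1 x = legendre_plus X2 x /\
                        legendre_minus X1 x = legendre_minus X2 x) &
      strongly_equivalent D X1 X2].
Proof.
move=> oQ mg dV1 dV2 eqv _ _ r1 _.
have force q v : Q q -> f1 q v - f2 q v = grad V1 q - grad V2 q.
  move=> Qq; exact: (force_difference v oQ mg (dV1 q Qq) (dV2 q Qq) eqv Qq).
(* equivalent systems have equal equations of motion, by extensionality *)
have a12 : a1 = a2.
  congr (method _ h c); apply/funext => x; apply/funext => t.
  exact: (propext (eqv x t)).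
have forces q0 q1 : D (q0, q1) ->
   fdp X1 q0 q1 - fdp X2 q0 q1 = D2 (Ld X2) q0 q1 - D2 (Ld X1) q0 q1 /\
   fdm X2 q0 q1 - fdm X1 q0 q1 = D1 (Ld X1) q0 q1 - D1 (Ld X2) q0 q1.
  move=> D01; rewrite /X2 -a12.
  have dg q (Qq : Q q) : differentiable g q by have [] := mg q Qq.
  exact: (discretize_sub b h dg dV1 dV2 force r1 D01).
have legendre x : D x -> legendre_plus X1 x = legendre_plus X2 x /\
                         legendre_minus X1 x = legendre_minus X2 x.
  case: x => q0 q1 /forces [fp fm].
  exact: (@legendre_eq _ _ X1 X2 (q0, q1) fp fm).
split; [exact: force | exact: forces | exact: legendre |].
exact: (legendre_strongly_equivalent legendre).
Qed.
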